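(* Let $\{A,L\}$ be a regular matrix pair, and let $(c_i^{(k)},s_i^{(k)},x_i^{(k)},y_i^{(k)},z_i^{(k)})$, $i=1,\dots,k$, be the approximate GSVD components computed (in exact arithmetic) by the $k$-step joint bidiagonalization (JBD) method. Let the residual of the $i$-th one be $$r_i^{(k)}=\begin{pmatrix}A x_i^{(k)}-c_i^{(k)}y_i^{(k)}\\ Lx_i^{(k)}-s_i^{(k)}z_i^{(k)}\\ s_i^{(k)}A^{\mathrm T}y_i^{(k)}-c_i^{(k)}L^{\mathrm T}z_i^{(k)}\end{pmatrix}.$$ Then for $i=1,\dots,k$, $$\|r_i^{(k)}\|\le\|R\|\left|s_i^{(k)}\alpha_{k+1}e_{k+1}^{\mathrm T}p_i^{(k)}-c_i^{(k)}\bar\beta_ke_k^{\mathrm T}\bar p_i^{(k)}\right|$$ and $$\|r_i^{(k)}\|\le\|R\|\left|\frac{\alpha_{k+1}\beta_{k+1}}{c_i^{(k)}s_i^{(k)}}e_k^{\mathrm T}w_i^{(k)}\right|.$$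
   Context: $\|\cdot\|$ is the 2-norm; $e_i$ is the $i$-th column of an identity matrix of appropriate size. **Setting.** $A\in\mathbb{R}^{m\times n}$, $L\in\mathbb{R}^{p\times n}$, $m+p\ge n$, $\operatorname{rank}((A^{\mathrm T},L^{\mathrm T})^{\mathrm T})=n$ (regularity), with economy QR factorization $\begin{pmatrix}A\\L\end{pmatrix}=QR=\begin{pmatrix}Q_A\\Q_L\end{pmatrix}R$. **JBD process.** The $k$-step JBD process started with a unit vector $u_1\in\mathbb{R}^m$, assumed not to break down, is in exact arithmetic equivalent to the two Lanczos bidiagonalizations with $v_1=Q_A^{\mathrm T}u_1/\|Q_A^{\mathrm T}u_1\|$ and $\hat v_1=v_1$: $$Q_AV_k=U_{k+1}B_k,\quad Q_A^{\mathrm T}U_{k+1}=V_kB_k^{\mathrm T}+\alpha_{k+1}v_{k+1}e_{k+1}^{\mathrm T},$$ $$Q_L\widehat V_k=\widehat U_k\widehat B_k,\quad Q_L^{\mathrm T}\widehat U_k=\widehat V_k\widehat B_k^{\mathrm T}+\hat\beta_k\hat v_{k+1}e_k^{\mathrm T}.$$ Here $U_{k+1}=(u_1,\dots,u_{k+1})$, $V_{k+1}=(V_k,v_{k+1})=(v_1,\dots,v_{k+1})$, $\widehat U_k=(\hat u_1,\dots,\hat u_k)$, $\widehat V_k=(\hat v_1,\dots,\hat v_k)$ have orthonormal columns; $B_k\in\mathbb{R}^{(k+1)\times k}$ is lower bidiagonal with diagonal $\alpha_1,\dots,\alpha_k$ and subdiagonal $\beta_2,\dots,\beta_{k+1}$;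 $\widehat B_k\in\mathbb{R}^{k\times k}$ is upper bidiagonal with diagonal $\hat\alpha_1,\dots,\hat\alpha_k$ and superdiagonal $\hat\beta_1,\dots,\hat\beta_{k-1}$; all $\alpha_i,\beta_i,\hat\alpha_i$ are positive. Moreover (known facts) $\hat v_{i+1}=(-1)^iv_{i+1}$ and $\hat\alpha_i\hat\beta_i=\alpha_{i+1}\beta_{i+1}$ for $i=1,\dots,k$. Put $D_k=\operatorname{diag}(1,-1,\dots,(-1)^{k-1})$, $\bar B_k=\widehat B_kD_k$, $\bar\beta_k=(-1)^k\hat\beta_k$, $H_k=R^{-1}V_k$. Then $AH_k=U_{k+1}B_k$, $LH_k=\widehat U_k\bar B_k$ and $B_k^{\mathrm T}B_k+\bar B_k^{\mathrm T}\bar B_k=I_k$. **JBD method.** Let the SVDs of $B_k,\bar B_k$ (equivalently the GSVD of $\{B_k,\bar B_k\}$) be $$B_k=P_k\Theta_kW_k^{\mathrm T},\ \Theta_k=\operatorname{diag}(c_1^{(k)},\dots,c_k^{(k)}),\qquad \bar B_k=\bar P_k\Psi_kW_k^{\mathrm T},\ \Psi_k=\operatorname{diag}(s_1^{(k)},\dots,s_k^{(k)}),$$ with $1>c_1^{(k)}>\cdots>c_k^{(k)}>0$, $0<s_1^{(k)}<\cdots<s_k^{(k)}<1$, $(c_i^{(k)})^2+(s_i^{(k)})^2=1$, $P_k\in\mathbb{R}^{(k+1)\times k}$ with orthonormal columns, $\bar P_k,W_k\in\mathbb{R}^{k\times k}$ orthogonal; $p_i^{(k)},\bar p_i^{(k)},w_i^{(k)}$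 denote the $i$-th columns of $P_k,\bar P_k,W_k$. The approximate GSVD components are given by $\{c_i^{(k)},s_i^{(k)}\}$, $x_i^{(k)}=H_kw_i^{(k)}=R^{-1}V_kw_i^{(k)}$, $y_i^{(k)}=U_{k+1}p_i^{(k)}$, $z_i^{(k)}=\widehat U_k\bar p_i^{(k)}$. *)

(* Defs.v *)
From mathcomp Require Import all_boot all_order all_algebra.
From mathcomp Require Import classical_sets reals.

Set Implicit Arguments.
Unset Strict Implicit.
Unset Printing Implicit Defensive.

Import Order.TTheory GRing.Theory Num.Theory.
Local Open Scope ring_scope.

(* Indexing: scalars and vectors produced by the bidiagonalizations are
   sequences [nat -> _] read from index 1 on (u 1, u 2, ...); only the values
   in the ranges constrained below matter. *)

Section Definitions.
Variable F : realType.

Definition norm2 (n : nat) (x : 'cV[F]_n) : F :=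
  Num.sqrt (\sum_(i < n) x i 0 ^+ 2).

(* Spectral norm.  For n = 0 the set is empty and the supremum is 0. *)
Definition mxnorm2 (m n : nat) (M : 'M[F]_(m, n)) : F :=
  sup [set norm2 (M *m x) | x in [set x : 'cV[F]_n | norm2 x = 1]]%classic.

Definition dotv (n : nat) (x y : 'cV[F]_n) : F := (x^T *m y) 0 0.

(* The j-th column of the identity, j counted from 1. *)
Definition unitv (n j : nat) : 'cV[F]_n := \col_(i < n) (i.+1 == j)%:R.

Definition orthonormal_cols (m n : nat) (M : 'M[F]_(m, n)) : Prop :=
  M^T *m M = 1%:M.

(* (x 1, ..., x k) *)
Definition cols (n : nat) (x : nat -> 'cV[F]_n) (k : nat) : 'M[F]_(n, k) :=
  \matrix_(i < n, j < k) x j.+1 i 0.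

Definition regular_pair (m p n : nat) (A : 'M[F]_(m, n)) (L : 'M[F]_(p, n))
  : Prop := (n <= m + p)%N /\ \rank (col_mx A L) = n.

Record economy_qr (m p n : nat) (A : 'M[F]_(m, n)) (L : 'M[F]_(p, n))
    (QA : 'M[F]_(m, n)) (QL : 'M[F]_(p, n)) (R : 'M[F]_n) : Prop := EconomyQR {
  qr_factor : col_mx A L = col_mx QA QL *m R;
  qr_orthonormal : orthonormal_cols (col_mx QA QL);
  (* [is_trig_mx] means lower triangular *)
  qr_upper : is_trig_mx R^T
}.

(* Diagonal al 1, ..., al k; subdiagonal be 2, ..., be k.+1. *)
Definition lower_bidiag (k : nat) (al be : nat -> F) : 'M[F]_(k.+1, k) :=
  \matrix_(i < k.+1, j < k)
    if i == j :> nat then al j.+1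
    else if i == j.+1 :> nat then be i.+1 else 0.

(* Diagonal ah 1, ..., ah k; superdiagonal bh 1, ..., bh k.-1. *)
Definition upper_bidiag (k : nat) (ah bh : nat -> F) : 'M[F]_k :=
  \matrix_(i < k, j < k)
    if i == j :> nat then ah i.+1
    else if j == i.+1 :> nat then bh i.+1 else 0.

(* The k-step process in exact arithmetic and without breakdown, as a pair of
   Lanczos bidiagonalizations of QA and QL.  Every vector is normalized and
   every coefficient is positive, including the last v k.+1, vh k.+1, al k.+1
   and bh k.  The identities
     vh i.+1 = (-1)^i v i.+1   and   ah i * bh i = al i.+1 * be i.+1
   (1 <= i <= k) are consequences of these conditions and are not assumed. *)
Record jbd_process (m p n k : nat) (QA : 'M[F]_(m, n)) (QL : 'M[F]_(p, n))
    (u : nat -> 'cV[F]_m) (v : nat -> 'cV[F]_n)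
    (uh : nat -> 'cV[F]_p) (vh : nat -> 'cV[F]_n)
    (al be ah bh : nat -> F) : Prop := JBDProcess {
  jbd_u1 : norm2 (u 1%N) = 1;
  jbd_v1 : v 1%N = (norm2 (QA^T *m u 1%N))^-1 *: (QA^T *m u 1%N);
  jbd_vh1 : vh 1%N = v 1%N;
  jbd_QA : QA *m cols v k = cols u k.+1 *m lower_bidiag k al be;
  jbd_QAT : QA^T *m cols u k.+1 =
    cols v k *m (lower_bidiag k al be)^T
    + al k.+1 *: (v k.+1 *m (unitv k.+1 k.+1)^T);
  jbd_QL : QL *m cols vh k = cols uh k *m upper_bidiag k ah bh;
  jbd_QLT : QL^T *m cols uh k =
    cols vh k *m (upper_bidiag k ah bh)^T
    + bh k *: (vh k.+1 *m (unitv k k)^T);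
  jbd_U : orthonormal_cols (cols u k.+1);
  jbd_V : orthonormal_cols (cols v k.+1);
  jbd_Uh : orthonormal_cols (cols uh k);
  jbd_Vh : orthonormal_cols (cols vh k.+1);
  jbd_al : forall i : nat, (1 <= i <= k.+1)%N -> 0 < al i;
  jbd_be : forall i : nat, (2 <= i <= k.+1)%N -> 0 < be i;
  jbd_ah : forall i : nat, (1 <= i <= k)%N -> 0 < ah i;
  jbd_bh : forall i : nat, (1 <= i <= k)%N -> 0 < bh i
}.

Definition altsign_mx (k : nat) : 'M[F]_k :=
  diag_mx (\row_(j < k) (-1) ^+ j).

Definition Bbar (k : nat) (ah bh : nat -> F) : 'M[F]_k :=
  upper_bidiag k ah bh *m altsign_mx k.

Definition betabar (k : nat) (bh : nat -> F) : F := (-1) ^+ k * bh k.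

(* The SVDs B = P diag(c) W^T and Bb = Pb diag(s) W^T with a common W. *)
Record gsvd (k : nat) (B : 'M[F]_(k.+1, k)) (Bb : 'M[F]_k) (c s : 'rV[F]_k)
    (P : 'M[F]_(k.+1, k)) (Pb W : 'M[F]_k) : Prop := GSVD {
  gsvd_B : B = P *m diag_mx c *m W^T;
  gsvd_Bb : Bb = Pb *m diag_mx s *m W^T;
  gsvd_P : orthonormal_cols P;
  gsvd_Pb : orthonormal_cols Pb;
  gsvd_W : orthonormal_cols W;
  gsvd_c_bounds : forall i : 'I_k, 0 < c 0 i < 1;
  gsvd_s_bounds : forall i : 'I_k, 0 < s 0 i < 1;
  gsvd_c_decr : forall i j : 'I_k, (i < j)%N -> c 0 j < c 0 i;
  gsvd_s_incr : forall i j : 'I_k, (i < j)%N -> s 0 i < s 0 j;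
  gsvd_cs : forall i : 'I_k, c 0 i ^+ 2 + s 0 i ^+ 2 = 1
}.

Definition jbd_x (n k : nat) (R : 'M[F]_n) (v : nat -> 'cV[F]_n)
    (W : 'M[F]_k) (i : 'I_k) : 'cV[F]_n :=
  invmx R *m cols v k *m col i W.

Definition jbd_y (m k : nat) (u : nat -> 'cV[F]_m) (P : 'M[F]_(k.+1, k))
    (i : 'I_k) : 'cV[F]_m :=
  cols u k.+1 *m col i P.

Definition jbd_z (p k : nat) (uh : nat -> 'cV[F]_p) (Pb : 'M[F]_k)
    (i : 'I_k) : 'cV[F]_p :=
  cols uh k *m col i Pb.

Definition gsvd_residual (m p n : nat) (A : 'M[F]_(m, n)) (L : 'M[F]_(p, n))
    (c s : F) (x : 'cV[F]_n) (y : 'cV[F]_m) (z : 'cV[F]_p)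
    : 'cV[F]_(m + (p + n)) :=
  col_mx (A *m x - c *: y)
    (col_mx (L *m x - s *: z) (s *: (A^T *m y) - c *: (L^T *m z))).

End Definitions.

Arguments unitv {F} n j.

(* Main.v *)
(* Since QA^T QA + QL^T QL = 1, the two bidiagonalizations are Lanczos processes
   for a matrix and its complement to 1 with the same starting vector, so
   vh_(j+1) = (-1)^j v_(j+1) and ah_j bh_j = al_(j+1) be_(j+1).  The first two
   residual blocks therefore vanish and the third is R^T (g v_(k+1)), where g is
   the scalar in the first bound.  The last rows of B w = c p and Bb w = s pb give
   e_(k+1)^T p = be_(k+1) w_k / c and e_k^T pb = (-1)^(k-1) ah_k w_k / s, hence
   g = (s/c + c/s) al_(k+1) be_(k+1) w_k, and c^2 + s^2 = 1 yields the second
   bound. *)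
Require Import Defs.
From mathcomp Require Import all_boot all_order all_algebra.
From mathcomp Require Import classical_sets reals.
From mathcomp Require Import ring lra.

Import Order.TTheory GRing.Theory Num.Theory.
Local Open Scope ring_scope.

(** * Inner product and Euclidean norm *)

Lemma dotvE {F : realType} {n : nat} (x y : 'cV[F]_n) :
  dotv x y = \sum_i x i 0 * y i 0.
Proof. by rewrite /dotv mxE; apply: eq_bigr => i _; rewrite mxE. Qed.

Lemma dotvC {F : realType} {n : nat} (x y : 'cV[F]_n) : dotv x y = dotv y x.
Proof. by rewrite !dotvE; apply: eq_bigr => i _; rewrite mulrC. Qed.

Lemma dotvDr {F : realType} {n : nat} (x y z : 'cV[F]_n) :
  dotv x (y + z) = dotv x y + dotv x z.
Proof. by rewrite /dotv mulmxDr mxE. Qed.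

Lemma dotvZr {F : realType} {n : nat} (a : F) (x y : 'cV[F]_n) :
  dotv x (a *: y) = a * dotv x y.
Proof. by rewrite /dotv -scalemxAr mxE. Qed.

Lemma dotvDl {F : realType} {n : nat} (x y z : 'cV[F]_n) :
  dotv (x + y) z = dotv x z + dotv y z.
Proof. by rewrite dotvC dotvDr !(dotvC z). Qed.

Lemma dotvZl {F : realType} {n : nat} (a : F) (x y : 'cV[F]_n) :
  dotv (a *: x) y = a * dotv x y.
Proof. by rewrite dotvC dotvZr dotvC. Qed.

Lemma dotv_mulmx {F : realType} {m n : nat} (M : 'M[F]_(m, n)) x y :
  dotv (M *m x) y = dotv x (M^T *m y).
Proof. by rewrite /dotv trmx_mul mulmxA. Qed.

Lemma dotvv_ge0 {F : realType} {n : nat} (x : 'cV[F]_n) : 0 <= dotv x x.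
Proof. by rewrite dotvE sumr_ge0 // => i _; rewrite -expr2 sqr_ge0. Qed.

Lemma dotvv_eq0 {F : realType} {n : nat} (x : 'cV[F]_n) :
  dotv x x = 0 -> x = 0.
Proof.
rewrite dotvE => /eqP; rewrite psumr_eq0 => [/allP x0|i _]; last first.
  by rewrite -expr2 sqr_ge0.
apply/colP => i; rewrite mxE; apply/eqP.
by have := x0 i (mem_index_enum i); rewrite -expr2 sqrf_eq0.
Qed.

Lemma norm2E {F : realType} {n : nat} (x : 'cV[F]_n) :
  norm2 x = Num.sqrt (dotv x x).
Proof.
by rewrite /norm2 dotvE; congr Num.sqrt; apply: eq_bigr => i _; rewrite expr2.
Qed.

Lemma sqr_norm2 {F : realType} {n : nat} (x : 'cV[F]_n) :
  norm2 x ^+ 2 = dotv x x.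
Proof. by rewrite norm2E sqr_sqrtr ?dotvv_ge0. Qed.

Lemma norm2_ge0 {F : realType} {n : nat} (x : 'cV[F]_n) : 0 <= norm2 x.
Proof. exact: sqrtr_ge0. Qed.

Lemma norm20 {F : realType} {n : nat} : norm2 (0 : 'cV[F]_n) = 0.
Proof. by rewrite norm2E /dotv mulmx0 mxE sqrtr0. Qed.

Lemma norm2_eq0 {F : realType} {n : nat} (x : 'cV[F]_n) :
  norm2 x = 0 -> x = 0.
Proof. by move=> x0; apply: dotvv_eq0; rewrite -sqr_norm2 x0 expr0n. Qed.

Lemma norm2Z {F : realType} {n : nat} (a : F) (x : 'cV[F]_n) :
  norm2 (a *: x) = `|a| * norm2 x.
Proof.
rewrite !norm2E dotvZl dotvZr mulrA -expr2 sqrtrM ?sqr_ge0 //.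
by rewrite sqrtr_sqr.
Qed.

Lemma norm2_col_mx0l {F : realType} {m n : nat} (x : 'cV[F]_n) :
  norm2 (col_mx (0 : 'cV[F]_m) x) = norm2 x.
Proof. by rewrite !norm2E /dotv tr_col_mx mul_row_col mulmx0 add0r. Qed.

Lemma cauchy_schwarz {F : realType} {n : nat} (x y : 'cV[F]_n) :
  dotv x y <= norm2 x * norm2 y.
Proof.
have [x0|x0] := eqVneq (norm2 x) 0.
  by rewrite x0 (norm2_eq0 _ x0) /dotv trmx0 mul0mx mxE mul0r.
have [y0|y0] := eqVneq (norm2 y) 0.
  by rewrite y0 (norm2_eq0 _ y0) /dotv mulmx0 mxE mulr0.
have xy_gt0 : 0 < norm2 x * norm2 y by rewrite mulr_gt0 // lt0r norm2_ge0 ?x0 ?y0.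
(* This square expands to twice the product of the norms times the Cauchy-Schwarz gap. *)
have := dotvv_ge0 (norm2 y *: x - norm2 x *: y).
rewrite -scaleNr !(dotvDl, dotvDr, dotvZl, dotvZr) (dotvC y) -!sqr_norm2 => h.
have {h}: 0 <= (norm2 x * norm2 y) * (norm2 x * norm2 y - dotv x y) by lra.
by rewrite pmulr_rge0 // subr_ge0.
Qed.

(** * Spectral norm *)

(** The Frobenius norm is the bound: by Cauchy-Schwarz each entry of [M *m x] is at most the norm of
    its row. Boundedness is what makes the supremum in [mxnorm2] an upper bound. *)
Lemma norm2_image_ubound {F : realType} {m n : nat} (M : 'M[F]_(m, n)) :
  has_ubound [set norm2 (M *m x) | x in [set x : 'cV[F]_n | norm2 x = 1]]%classic.
Proof.
exists (Num.sqrt (\sum_i norm2 (row i M)^T ^+ 2)) => _ /= [x x1 <-].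
rewrite /norm2 ler_wsqrtr // ler_sum // => i _.
have MyE y : (M *m y) i 0 = dotv (row i M)^T y.
  by rewrite /dotv trmxK -row_mul [RHS]mxE.
have hi := cauchy_schwarz (row i M)^T x.
(* Applying Cauchy-Schwarz to [-x] bounds the entry from below, so both factors of the difference of
   squares are nonnegative. *)
have lo := cauchy_schwarz (row i M)^T (- 1 *: x).
move: hi lo; rewrite norm2Z x1 dotvZr normrN1 !mulr1 mulN1r MyE => hi lo.
rewrite -/(norm2 _) -subr_ge0 subr_sqr mulr_ge0 ?subr_ge0 //; lra.
Qed.

Lemma norm2_mulmx {F : realType} {m n : nat} (M : 'M[F]_(m, n)) x :
  norm2 (M *m x) <= mxnorm2 M * norm2 x.
Proof.
have [x0|x0] := eqVneq (norm2 x) 0.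
  by rewrite x0 (norm2_eq0 _ x0) mulmx0 norm20 mulr0.
have x_gt0 : 0 < norm2 x by rewrite lt0r x0 norm2_ge0.
have u1 : norm2 ((norm2 x)^-1 *: x) = 1.
  by rewrite norm2Z ger0_norm ?invr_ge0 ?norm2_ge0 // mulVf.
rewrite -ler_pdivrMr // mulrC.
have -> : (norm2 x)^-1 * norm2 (M *m x) = norm2 (M *m ((norm2 x)^-1 *: x)).
  by rewrite -scalemxAr norm2Z ger0_norm // invr_ge0 norm2_ge0.
by apply: ub_le_sup (norm2_image_ubound M) _ _; exists ((norm2 x)^-1 *: x).
Qed.

Lemma mxnorm2_ge0 {F : realType} {m n : nat} (M : 'M[F]_(m, n)) :
  0 <= mxnorm2 M.
Proof.
case: n M => [|n] M.
  rewrite /mxnorm2 (_ : [set _ | _ in _]%classic = set0) ?sup0 //.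
  apply/seteqP; split=> // _ [x /= x1 _]; move: x1.
  by rewrite (_ : x = 0) ?norm20 => [/eqP|]; rewrite ?[x]flatmx0 // eq_sym oner_eq0.
have e1 : norm2 (delta_mx ord0 0 : 'cV[F]_n.+1) = 1.
  by rewrite norm2E /dotv trmx_delta mul_delta_mx mxE !eqxx sqrtr1.
by have := norm2_mulmx M (delta_mx ord0 0); rewrite e1 mulr1; apply: le_trans (norm2_ge0 _).
Qed.

(** Cauchy-Schwarz on the squared norm of [M^T *m x], seen as the inner product of [M *m (M^T *m x)]
    with [x], followed by division by the norm of [M^T *m x]. It lets [mxnorm2 R] bound a residual
    in which [R^T] appears. *)
Lemma norm2_mulmx_tr {F : realType} {m n : nat} (M : 'M[F]_(m, n)) x :
  norm2 (M^T *m x) <= mxnorm2 M * norm2 x.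
Proof.
have [y0|y0] := eqVneq (norm2 (M^T *m x)) 0.
  by rewrite y0 mulr_ge0 ?mxnorm2_ge0 ?norm2_ge0.
have y_gt0 : 0 < norm2 (M^T *m x) by rewrite lt0r y0 norm2_ge0.
rewrite -(ler_pM2l y_gt0) -expr2 sqr_norm2 -dotv_mulmx.
apply: le_trans (cauchy_schwarz _ _) _.
rewrite mulrCA mulrA ler_wpM2r ?norm2_ge0 //.
exact: norm2_mulmx.
Qed.

(** * Linear combinations of indexed vectors *)

Lemma mul_cols {F : realType} {n k : nat} (x : nat -> 'cV[F]_n) (y : 'cV[F]_k) :
  cols x k *m y = \sum_(i < k) y i 0 *: x i.+1.
Proof.
apply/colP => r; rewrite mxE summxE; apply: eq_bigr => i _.
by rewrite !mxE mulrC.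
Qed.

Lemma col_cols {F : realType} {n k : nat} (x : nat -> 'cV[F]_n) (j : 'I_k) :
  col j (cols x k) = x j.+1.
Proof. by apply/colP => r; rewrite !mxE. Qed.

(** A column of a bidiagonal matrix or of its transpose has at most two nonzero entries. The guards
    absorb positions falling past the last row. *)
Lemma mul_cols_bidiag {F : realType} {n k : nat} (x : nat -> 'cV[F]_n)
    (y : 'cV[F]_k) (a b : nat) (al be : F) : a != b ->
  (forall i : 'I_k, y i 0 = if i == a :> nat then al
                            else if i == b :> nat then be else 0) ->
  cols x k *m y = (if (a < k)%N then al *: x a.+1 else 0)
    + (if (b < k)%N then be *: x b.+1 else 0).
Proof.
move=> ab yE; rewrite mul_cols.
have delta g c : (if (c < k)%N then g *: x c.+1 else 0)
    = \sum_(i < k) (if i == c :> nat then g *: x i.+1 else 0).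
  by rewrite -big_mkcond (big_ord1_eq _ (fun i => g *: x i.+1)).
rewrite !delta -big_split; apply: eq_bigr => i _ /=; rewrite yE.
case: eqP => [->|_]; first by rewrite (negPf ab) addr0.
by case: eqP => _; rewrite add0r // scale0r.
Qed.

(** * Lanczos recurrences for two matrices summing to the identity *)

Lemma dotv_orthonormal_cols {F : realType} {n k : nat} {x : nat -> 'cV[F]_n} :
  orthonormal_cols (cols x k) ->
  forall i j : nat, (i < k)%N -> (j < k)%N ->
    dotv (x i.+1) (x j.+1) = (i == j)%:R.
Proof.
move=> /matrixP xO i j ik jk; have := xO (Ordinal ik) (Ordinal jk).
rewrite !mxE -val_eqE /= => <-; rewrite dotvE.
by apply: eq_bigr => r _; rewrite !mxE.
Qed.

(* In the induction step orthogonality kills every component except those along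
   [vh j.+2] and [v j.+2], leaving
   [th j.+1 *: vh j.+2 = - (-1) ^+ j *: (t j.+1 *: v j.+2)];
   the coefficients then agree because both vectors are normalized. *)
Lemma lanczos_complement {F : realType} {n k : nat} (M N : 'M[F]_n)
    (v vh : nat -> 'cV[F]_n) (d t dh th : nat -> F) :
  M + N = 1%:M ->
  (forall j, (j < k)%N -> M *m v j.+1 =
     d j *: v j.+1 + t j.+1 *: v j.+2
     + (if j is _.+1 then t j *: v j else 0)) ->
  (forall j, (j < k)%N -> N *m vh j.+1 =
     dh j *: vh j.+1 + th j.+1 *: vh j.+2
     + (if j is _.+1 then th j *: vh j else 0)) ->
  orthonormal_cols (cols v k.+1) -> orthonormal_cols (cols vh k.+1) ->
  (forall j, (j < k)%N -> 0 < t j.+1) ->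
  (forall j, (j < k)%N -> 0 < th j.+1) ->
  vh 1%N = v 1%N ->
  forall j, (j <= k)%N ->
    vh j.+1 = (-1) ^+ j *: v j.+1 /\ ((0 < j)%N -> th j = t j).
Proof.
move=> MN hM hN /dotv_orthonormal_cols vO /dotv_orthonormal_cols vhO t0 th0 e1.
(* The induction also carries a relation between the backward terms of the two recurrences; at
   [j = 0] both are zero. *)
move=> j jk; suff: vh j.+1 = (-1) ^+ j *: v j.+1 /\
    (((0 < j)%N -> th j = t j) /\
    (if j is _.+1 then th j *: vh j else 0)
      = - (-1) ^+ j *: (if j is _.+1 then t j *: v j else 0)) by case=> -> [].
elim: j jk => [|j IH] jk; first by rewrite expr0 scale1r scaler0.
have [E [_ Q]] := IH (ltnW jk).
have sq : (-1) ^+ j * (-1) ^+ j = 1 :> F by rewrite -expr2 sqrr_sign.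
(* Comparing [N *m vh j.+1] with [vh j.+1 - M *m vh j.+1] makes the backward terms cancel, by the
   carried relation. *)
have resid : th j.+1 *: vh j.+2 = (1 - d j - dh j) *: vh j.+1
    + (- (-1) ^+ j * t j.+1) *: v j.+2.
  have : N *m vh j.+1 = vh j.+1 - (-1) ^+ j *: (M *m v j.+1).
    by rewrite scalemxAr -E -{2}[vh _]mul1mx -mulmxBl -MN addrC addKr.
  rewrite hN // hM // Q E => /eqP.
  rewrite -subr_eq0 => /eqP h; apply/eqP; rewrite -subr_eq0 -h.
  apply/eqP/colP => r; rewrite !mxE; ring.
have jk1 : (j < k.+1)%N by exact: ltnW.
have orth1 : 1 - d j - dh j = 0.
  have := congr1 (dotv (vh j.+1)) resid.
  rewrite dotvDr !dotvZr !vhO // E dotvZl vO // eqxx.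
  by rewrite (ltn_eqF (ltnSn j)) !mulr0 mulr1 addr0.
have tE : th j.+1 = t j.+1.
  have := congr1 (fun x => norm2 x ^+ 2) resid.
  rewrite orth1 scale0r add0r !sqr_norm2 !(dotvZl, dotvZr) vhO // vO // eqxx !mulr1.
  rewrite mulrACA mulrNN sq mul1r -!expr2 => /eqP.
  rewrite eqrXn2 ?ltW ?t0 ?th0 // => /eqP //.
have vE : vh j.+2 = (-1) ^+ j.+1 *: v j.+2.
  apply: (scalerI (lt0r_neq0 (th0 _ jk))).
  by rewrite resid orth1 scale0r add0r tE scalerA exprS mulN1r mulrC.
split=> //; split=> //=.
by rewrite tE E exprS mulN1r opprK !scalerA mulrC.
Qed.

(** * Columns of products with the bidiagonal factors *)

Lemma dotv_unitv_last {F : realType} {k : nat} (x : 'cV[F]_k.+1) :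
  dotv (unitv k.+1 k.+1) x = x ord_max 0.
Proof.
rewrite dotvE (bigD1 ord_max) //= big1 => [|i /negPf ne].
  by rewrite mxE eqxx mul1r addr0.
by rewrite mxE eqSS (_ : (i == k :> nat) = false) ?mul0r // -ne -val_eqE.
Qed.

Lemma mul_col_rank1 {F : realType} {n k : nat} (x : 'cV[F]_n) (y z : 'cV[F]_k) :
  (x *m y^T) *m z = dotv y z *: x.
Proof. by rewrite -mulmxA [y^T *m z]mx11_scalar mul_mx_scalar. Qed.

Lemma cols_lower_bidiag {F : realType} {m k : nat} (u : nat -> 'cV[F]_m)
    (al be : nat -> F) (j : 'I_k) :
  col j (cols u k.+1 *m lower_bidiag k al be)
  = al j.+1 *: u j.+1 + be j.+2 *: u j.+2.
Proof.
rewrite colE -mulmxA -colE.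
rewrite (mul_cols_bidiag _ _ j j.+1 (al j.+1) (be j.+2)) ?ltn_eqF //.
  by rewrite !ltnS ltn_ord ltnW.
by move=> i; rewrite !mxE; case: eqP => // _; case: eqP => [->|].
Qed.

Lemma cols_tr_lower_bidiag {F : realType} {n k : nat} (v : nat -> 'cV[F]_n)
    (al be : nat -> F) (j : 'I_k.+1) :
  col j (cols v k *m (lower_bidiag k al be)^T)
  = (if (j < k)%N then al j.+1 *: v j.+1 else 0)
    + (if j : nat is _.+1 then be j.+1 *: v j else 0).
Proof.
rewrite colE -mulmxA -colE; case: j => [[|j] ltjk] /=.
  (* The first column has a single nonzero entry; position 1 is a dummy with coefficient 0. *)
  rewrite (mul_cols_bidiag _ _ 0 1 (al 1%N) 0) //.
    by rewrite scale0r if_same.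
  by move=> i; rewrite !mxE /= if_same (eq_sym 0%N); case: eqP => [->|].
rewrite (mul_cols_bidiag _ _ j.+1 j (al j.+2) (be j.+2)) ?gtn_eqF //.
  by rewrite (_ : (j < k)%N).
move=> i; rewrite !mxE /= eqSS !(eq_sym _ (i : nat)).
by case: eqP => [->|].
Qed.

Lemma cols_upper_bidiag {F : realType} {p k : nat} (x : nat -> 'cV[F]_p)
    (ah bh : nat -> F) (j : 'I_k) :
  col j (cols x k *m upper_bidiag k ah bh)
  = ah j.+1 *: x j.+1 + (if j : nat is _.+1 then bh j *: x j else 0).
Proof.
rewrite colE -mulmxA -colE; case: j => [[|j] ltjk] /=.
  rewrite (mul_cols_bidiag _ _ 0 1 (ah 1%N) 0) ?ltjk //.
    by rewrite scale0r if_same.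
  by move=> i; rewrite !mxE /= if_same; case: eqP => [->|].
rewrite (mul_cols_bidiag _ _ j.+1 j (ah j.+2) (bh j.+1)) ?gtn_eqF //.
  by rewrite ltjk (ltnW ltjk).
move=> i; rewrite !mxE /= eqSS (eq_sym j).
by do 2![case: eqP => [->|] //].
Qed.

Lemma cols_tr_upper_bidiag {F : realType} {n k : nat} (vh : nat -> 'cV[F]_n)
    (ah bh : nat -> F) (j : 'I_k) :
  col j (cols vh k *m (upper_bidiag k ah bh)^T)
  = ah j.+1 *: vh j.+1 + (if (j.+1 < k)%N then bh j.+1 *: vh j.+2 else 0).
Proof.
rewrite colE -mulmxA -colE.
rewrite (mul_cols_bidiag _ _ j j.+1 (ah j.+1) (bh j.+1)) ?ltn_eqF // ?ltn_ord //.
by move=> i; rewrite !mxE (eq_sym (j : nat)).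
Qed.

Lemma col_mul_unitv {F : realType} {n k : nat} (x : 'cV[F]_n) (j : 'I_k) :
  col j (x *m (unitv k k)^T) = (j.+1 == k)%:R *: x.
Proof.
apply/colP => r; rewrite !mxE big_ord1 !mxE mulrC.
by congr (_%:R * x r _); rewrite eq_sym.
Qed.

(** * Gram recurrences and sign relations of the JBD process *)

Section JBDProcess.
Context {F : realType} {m p n k : nat}.
Context {QA : 'M[F]_(m, n)} {QL : 'M[F]_(p, n)}.
Context {u : nat -> 'cV[F]_m} {v : nat -> 'cV[F]_n}.
Context {uh : nat -> 'cV[F]_p} {vh : nat -> 'cV[F]_n}.
Context {al be ah bh : nat -> F}.
Context (hQ : QA^T *m QA + QL^T *m QL = 1%:M).
Context (hjbd : jbd_process k QA QL u v uh vh al be ah bh).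

(** Eliminating the [u] vectors between the two bidiagonal relations leaves the three-term
    recurrence needed by [lanczos_complement]. *)
Lemma jbd_gram_QA (j : nat) : (j < k)%N ->
  QA^T *m QA *m v j.+1 =
    (al j.+1 ^+ 2 + be j.+2 ^+ 2) *: v j.+1 + (al j.+2 * be j.+2) *: v j.+2
    + (if j is _.+1 then (al j.+1 * be j.+1) *: v j else 0).
Proof.
move=> jk.
have colA : QA *m v j.+1 = al j.+1 *: u j.+1 + be j.+2 *: u j.+2.
  have := congr1 (col (Ordinal jk)) (jbd_QA hjbd).
  by rewrite cols_lower_bidiag colE -mulmxA -colE col_cols.
have colAT i : (i < k.+1)%N -> QA^T *m u i.+1 = al i.+1 *: v i.+1
    + (if i is _.+1 then be i.+1 *: v i else 0).
  move=> ik; have := congr1 (col (Ordinal ik)) (jbd_QAT hjbd).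
  rewrite linearD linearZ /= cols_tr_lower_bidiag col_mul_unitv colE -mulmxA -colE.
  rewrite col_cols /= => ->; rewrite addrAC; congr (_ + _).
  (* For [i = k] the vector [v k.+1] comes from the rank-one remainder; for smaller [i] that
     remainder has a zero column. *)
  have [ik'|ki] := ltnP i k.
    by rewrite eqSS ltn_eqF // scale0r scaler0 addr0.
  by rewrite (_ : i = k) ?eqxx ?scale1r ?add0r //; apply/eqP; rewrite eqn_leq ki -ltnS ik.
rewrite -mulmxA colA mulmxDr -!scalemxAr (colAT j.+1 jk) (colAT j (ltnW jk)) /=.
by case: j {jk colA} => [|j]; apply/colP => r; rewrite !mxE; ring.
Qed.

Lemma jbd_gram_QL (j : nat) : (j < k)%N ->
  QL^T *m QL *m vh j.+1 =
    (ah j.+1 ^+ 2 + (if j is _.+1 then bh j ^+ 2 else 0)) *: vh j.+1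
    + (ah j.+1 * bh j.+1) *: vh j.+2
    + (if j is _.+1 then (ah j * bh j) *: vh j else 0).
Proof.
move=> jk.
have colL : QL *m vh j.+1 = ah j.+1 *: uh j.+1
    + (if j is _.+1 then bh j *: uh j else 0).
  have := congr1 (col (Ordinal jk)) (jbd_QL hjbd).
  by rewrite cols_upper_bidiag colE -mulmxA -colE col_cols.
have colLT i : (i < k)%N ->
    QL^T *m uh i.+1 = ah i.+1 *: vh i.+1 + bh i.+1 *: vh i.+2.
  move=> ik; have := congr1 (col (Ordinal ik)) (jbd_QLT hjbd).
  rewrite linearD linearZ /= cols_tr_upper_bidiag col_mul_unitv colE -mulmxA -colE.
  rewrite col_cols /= => ->; rewrite -addrA; congr (_ + _).
  have [ik'|ki] := ltnP i.+1 k.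
    by rewrite ltn_eqF // scale0r scaler0 addr0.
  by rewrite (_ : k = i.+1) ?eqxx ?scale1r ?add0r //; apply/eqP; rewrite eqn_leq ki ik.
rewrite -mulmxA colL mulmxDr -!scalemxAr colLT //.
case: j jk {colL} => [|j] jk; last rewrite -scalemxAr colLT 1?ltnW //.
- by apply/colP => r; rewrite mulmx0 !mxE; ring.
- by apply/colP => r; rewrite !mxE; ring.
Qed.

(** By [hQ] the two Gram matrices sum to the identity, and their off-diagonal Lanczos coefficients
    are the products of bidiagonal entries being compared. *)
Lemma jbd_vh (j : nat) : (j <= k)%N ->
  vh j.+1 = (-1) ^+ j *: v j.+1 /\
  ((0 < j)%N -> ah j * bh j = al j.+1 * be j.+1).
Proof.
apply: (lanczos_complement _ _ _ _ _ (fun j => al j.+1 * be j.+1) _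
  (fun j => ah j * bh j) hQ jbd_gram_QA jbd_gram_QL).
- exact: jbd_V hjbd.
- exact: jbd_Vh hjbd.
- by move=> i ik; rewrite mulr_gt0 ?(jbd_al hjbd) ?(jbd_be hjbd).
- by move=> i ik; rewrite mulr_gt0 ?(jbd_ah hjbd) ?(jbd_bh hjbd).
- exact: jbd_vh1 hjbd.
Qed.

Lemma jbd_Vh_altsign : cols vh k = cols v k *m altsign_mx F k.
Proof.
rewrite mul_mx_diag; apply/matrixP => r j.
by rewrite !mxE (jbd_vh _ (ltnW (ltn_ord j))).1 mxE mulrC.
Qed.

End JBDProcess.

(** * Singular vectors, last rows and invertibility of [R] *)

Lemma altsign_mxK {F : realType} {k : nat} :
  altsign_mx F k *m altsign_mx F k = 1%:M.
Proof.
rewrite mulmx_diag -[1%:M]diag_const_mx; congr diag_mx.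
by apply/rowP => j; rewrite !mxE -expr2 sqrr_sign.
Qed.

(** Orthonormality of [W], respectively [P], collapses the SVD applied to one singular vector. A
    free row count [l] serves both the tall [B] and the square [Bbar]. *)
Lemma gsvd_vectors {F : realType} {l k : nat} {B : 'M[F]_(l, k)}
    {c : 'rV[F]_k} {P : 'M[F]_(l, k)} {W : 'M[F]_k} (i : 'I_k) :
  B = P *m diag_mx c *m W^T -> orthonormal_cols P -> orthonormal_cols W ->
  B *m col i W = c 0 i *: col i P /\ B^T *m col i P = c 0 i *: col i W.
Proof.
move=> -> PO WO.
have colD l' (M : 'M[F]_(l', k)) : col i (M *m diag_mx c) = c 0 i *: col i M.
  by rewrite mul_mx_diag; apply/colP => r; rewrite !mxE mulrC.
split.
  by rewrite [col i W]colE mulmxA -(mulmxA _ W^T) WO mulmx1 -colE colD.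
rewrite !trmx_mul trmxK tr_diag_mx [col i P]colE mulmxA.
by rewrite -!mulmxA (mulmxA _ P) PO mul1mx !mulmxA -colE colD.
Qed.

Lemma lower_bidiag_mul_last {F : realType} {k : nat} (al be : nat -> F)
    (w : 'cV[F]_k.+1) :
  (lower_bidiag k.+1 al be *m w) ord_max 0 = be k.+2 * w ord_max 0.
Proof.
rewrite mxE (bigD1 ord_max) //= big1 => [|j /negPf ne].
  by rewrite mxE /= gtn_eqF // eqxx addr0.
have jk : (j < k.+1)%N := ltn_ord j.
by rewrite mxE /= gtn_eqF // eqSS eq_sym (_ : (j == k :> nat) = false) ?mul0r //.
Qed.

(** The last row of an upper bidiagonal matrix holds only its diagonal entry; the sign is the last
    diagonal entry of [altsign_mx]. *)
Lemma Bbar_mul_last {F : realType} {k : nat} (ah bh : nat -> F)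
    (w : 'cV[F]_k.+1) :
  (Bbar k.+1 ah bh *m w) ord_max 0 = (-1) ^+ k * ah k.+1 * w ord_max 0.
Proof.
rewrite mxE (bigD1 ord_max) //= big1 => [|j /negPf ne].
  by rewrite /Bbar mul_mx_diag !mxE /= eqxx addr0 (mulrC (ah _)).
have jk : (j < k.+1)%N := ltn_ord j.
rewrite /Bbar mul_mx_diag !mxE /= (eq_sym k) (_ : (j == k :> nat) = false).
  by rewrite ltn_eqF // !mul0r.
by rewrite -ne -val_eqE.
Qed.

(** The stacked matrix has rank [n] and factors through [R], so [R] has full rank. *)
Lemma economy_qr_unit {F : realType} {m p n : nat}
    {A : 'M[F]_(m, n)} {L : 'M[F]_(p, n)} {QA QL R} :
  regular_pair A L -> economy_qr A L QA QL R -> R \in unitmx.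
Proof.
move=> [_ rk] [AL _ _]; rewrite -row_full_unit /row_full eqn_leq rank_leq_row.
by rewrite -[X in (X <= _)%N]rk AL mxrankM_maxr.
Qed.

(** * The residual and its two bounds *)

Theorem theorem3p3 (F : realType) (m p n k : nat)
    (A : 'M[F]_(m, n)) (L : 'M[F]_(p, n))
    (QA : 'M[F]_(m, n)) (QL : 'M[F]_(p, n)) (R : 'M[F]_n)
    (u : nat -> 'cV[F]_m) (v : nat -> 'cV[F]_n)
    (uh : nat -> 'cV[F]_p) (vh : nat -> 'cV[F]_n)
    (al be ah bh : nat -> F)
    (c s : 'rV[F]_k) (P : 'M[F]_(k.+1, k)) (Pb W : 'M[F]_k)
    (hreg : regular_pair A L)
    (hqr : economy_qr A L QA QL R)
    (hjbd : jbd_process k QA QL u v uh vh al be ah bh)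
    (hgsvd : gsvd (lower_bidiag k al be) (Bbar k ah bh) c s P Pb W)
    (i : 'I_k) :
  let ci := c 0 i in
  let si := s 0 i in
  let r := gsvd_residual A L ci si (jbd_x R v W i) (jbd_y u P i)
             (jbd_z uh Pb i) in
  norm2 r <= mxnorm2 R *
    `|si * al k.+1 * dotv (unitv k.+1 k.+1) (col i P)
      - ci * betabar k bh * dotv (unitv k k) (col i Pb)|
  /\
  norm2 r <= mxnorm2 R *
    `|al k.+1 * be k.+1 / (ci * si) * dotv (unitv k k) (col i W)|.
Proof.
move=> ci si r.
have hR := economy_qr_unit hreg hqr.
have [eA eL] : A = QA *m R /\ L = QL *m R.
  by apply: eq_col_mx; rewrite (qr_factor hqr) mul_col_mx.
have hQ : QA^T *m QA + QL^T *m QL = 1%:M.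
  by have := qr_orthonormal hqr; rewrite /orthonormal_cols tr_col_mx mul_row_col.
have hVh := jbd_Vh_altsign hQ hjbd.
have [hvh hab] := jbd_vh hQ hjbd _ (leqnn k).
have [Bw Btp] := gsvd_vectors i (gsvd_B hgsvd) (gsvd_P hgsvd) (gsvd_W hgsvd).
have [Bbw Bbtp] := gsvd_vectors i (gsvd_Bb hgsvd) (gsvd_Pb hgsvd) (gsvd_W hgsvd).
rewrite -/ci in Bw Btp; rewrite -/si in Bbw Bbtp.
set g := _ - ci * betabar k bh * _.
have rE : r = col_mx 0 (col_mx 0 (R^T *m (g *: v k.+1))).
  rewrite /r /gsvd_residual; congr col_mx; last congr col_mx.
  - rewrite eA /jbd_x /jbd_y -!mulmxA mulKVmx // mulmxA (jbd_QA hjbd).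
    by rewrite -mulmxA Bw -scalemxAr subrr.
  - have QLV : QL *m cols v k = cols uh k *m Bbar k ah bh.
      rewrite /Bbar mulmxA -(jbd_QL hjbd) hVh -!mulmxA altsign_mxK.
      by rewrite mulmx1.
    rewrite eL /jbd_x /jbd_z -!mulmxA mulKVmx // mulmxA QLV.
    by rewrite -mulmxA Bbw -scalemxAr subrr.
  (* Here and in [Lz] the component along [cols v k *m col i W] has coefficient [ci], respectively
     [si], so it cancels in the third block. *)
  have Ay : QA^T *m jbd_y u P i = ci *: (cols v k *m col i W)
      + (al k.+1 * dotv (unitv k.+1 k.+1) (col i P)) *: v k.+1.
    rewrite /jbd_y mulmxA (jbd_QAT hjbd) mulmxDl -scalemxAl mul_col_rank1.
    by rewrite -mulmxA Btp -scalemxAr scalerA.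
  have Lz : QL^T *m jbd_z uh Pb i = si *: (cols v k *m col i W)
      + (betabar k bh * dotv (unitv k k) (col i Pb)) *: v k.+1.
    rewrite /jbd_z mulmxA (jbd_QLT hjbd) mulmxDl -scalemxAl mul_col_rank1.
    (* The signs of the first [k] vectors turn [upper_bidiag] into [Bbar]; the sign of [vh k.+1]
       turns [bh k] into [betabar k bh]. *)
    rewrite hVh hvh -(mulmxA (cols v k)).
    have -> : altsign_mx F k *m (upper_bidiag k ah bh)^T = (Bbar k ah bh)^T.
      by rewrite trmx_mul tr_diag_mx.
    rewrite -mulmxA Bbtp -scalemxAr !scalerA; congr (_ + _ *: _).
    by rewrite /betabar; ring.
  rewrite eA eL !trmx_mul -!mulmxA Ay Lz {Ay Lz}.
  move: (cols v k *m col i W) => x; rewrite !scalemxAr -mulmxBr.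
  by congr (_ *m _); apply/colP => j; rewrite /g !mxE; ring.
have v1 : norm2 (v k.+1) = 1.
  by rewrite norm2E (dotv_orthonormal_cols (jbd_V hjbd)) // eqxx sqrtr1.
have bound : norm2 r <= mxnorm2 R * `|g|.
  rewrite rE !norm2_col_mx0l; apply: le_trans (norm2_mulmx_tr _ _) _.
  by rewrite norm2Z v1 mulr1.
suff gE : g = al k.+1 * be k.+1 / (ci * si) * dotv (unitv k k) (col i W).
  by rewrite -gE.
have /andP[c0 _] := gsvd_c_bounds hgsvd i.
have /andP[s0 _] := gsvd_s_bounds hgsvd i.
have cs := gsvd_cs hgsvd i.
rewrite -/ci -/si in c0 s0 cs.
clear hjbd hgsvd hVh hvh rE v1 bound r.
(* The index [i] excludes dimension 0; a successor dimension makes the last index [ord_max]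
   available. *)
case: k i c s P Pb W @ci @si @g hab Bw Btp Bbw Bbtp c0 s0 cs => [[]//|k] i c s P Pb W.
move=> ci si g hab Bw Btp Bbw Bbtp c0 s0 cs.
rewrite /g /betabar !dotv_unitv_last {g}.
have := congr1 (fun x : 'cV_k.+2 => x ord_max 0) Bw.
have := congr1 (fun x : 'cV_k.+1 => x ord_max 0) Bbw.
rewrite Bbar_mul_last lower_bidiag_mul_last ![(_ *: col _ _) _ _]mxE.
move: (col i P _ _) (col i Pb _ _) (col i W _ _) => a b w bE aE.
have cn := lt0r_neq0 c0; have sn := lt0r_neq0 s0.
have -> : a = be k.+2 * w / ci by rewrite aE mulrC mulKf.
have -> : b = (-1) ^+ k * ah k.+1 * w / si by rewrite bE mulrC mulKf.
(* [betabar] carries one more factor -1 than [b], so their signs multiply to [- e ^+ 2] and the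
   difference in [g] becomes a sum. *)
rewrite exprS; have := sqrr_sign F k; move: ((-1) ^+ k) => e e2.
transitivity ((si ^+ 2 * (al k.+2 * be k.+2) + ci ^+ 2 * (e ^+ 2 * (ah k.+1 * bh k.+1)))
    / (ci * si) * w).
  by field; rewrite cn sn.
by rewrite e2 hab // mul1r -mulrDl addrC cs mul1r.
Qed.
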